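(* Let $K\subseteq[0,1]^n$ be compact. A function $f:K\to[0,1]$ is implementable by a Bernoulli factory (on $K$) if and only if $f$ is continuous and both $f$ and $1-f$ are polynomially bounded on $K$.
   Context: A (multiparameter) Bernoulli factory with input $(p_1,\dots,p_n)$ is a (possibly infinite) rooted binary tree in which every node has either $2$ children or $0$ children (leaf). Each internal node is labelled either by an index $i\in[n]$ or by a constant $c\in(0,1)$; each leaf is labelled $0$ or $1$. To execute it with coins $p\in[0,1]^n$, start at the root; at a node labelled $i$ draw a fresh independent Bernoulli($p_i$) sample, at a node labelled $c$ a fresh independent Bernoulli($c$) sample; move to the child corresponding to the outcome; upon reaching a leaf output its label. $f:K\to[0,1]$ is implementable by a Bernoulli factory if there is such a tree which, for every $p\in K$, reaches a leaf almost surely and outputs $1$ with probability exactly $f(p)$. For a partition $[n]=A\sqcup S\sqcup B$, the open face is $F_{A,S,B}=\{p\in[0,1]^n: p_i=0\ (i\in A),\ 0<p_i<1\ (i\in S),\ p_i=1\ (i\in B)\}$. For $T\subseteq[n]$, $p^T=\prod_{i\in T}p_i$, $(1-p)^T=\prod_{i\in T}(1-p_i)$. A function $h:K\to[0,1]$ is polynomially bounded on $K$ if there exist an integer $m\ge0$ and a real $c>0$ such that for every open face $F_{A,S,B}$: if there is $q\in K\cap F_{A,S,B}$ with $h(q)>0$, then $h(p)\ge c\left((1-p)^A p^S(1-p)^S p^B\right)^m$ for all $p\in K$. *)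

(* Defs.v *)
From HB Require Import structures.
From mathcomp Require Import all_boot all_order all_algebra.
From mathcomp Require Import all_classical all_reals all_analysis.
Set Implicit Arguments. Unset Strict Implicit. Unset Printing Implicit Defensive.
Import Order.TTheory GRing.Theory Num.Theory.
Import numFieldNormedType.Exports.
Local Open Scope classical_set_scope.
Local Open Scope ring_scope.

Definition cd (R : realType) (n : nat) (p : 'rV[R]_n) (i : 'I_n) : R := p ord0 i.

Inductive label (R : realType) (n : nat) : Type :=
  | Coin of 'I_n
  | Const of R
  | Leaf of bool.
Arguments Coin {R n}. Arguments Const {R n}. Arguments Leaf {R n}.

(* A (possibly infinite) rooted binary tree: the node reached from the root by
   the sequence of coin outcomes s (true = outcome 1) carries label t s.
   Internal nodes have exactly the two children rcons s false / rcons s true;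
   nodes below a leaf are unreachable and irrelevant. *)
Definition factory (R : realType) (n : nat) := seq bool -> label R n.

Definition valid_factory (R : realType) (n : nat) (t : factory R n) : Prop :=
  forall s c, t s = Const c -> 0 < c < 1.

Fixpoint path_prob (R : realType) (n : nat) (t : factory R n) (p : 'rV[R]_n)
    (pre : seq bool) (s : seq bool) : R :=
  match s with
  | [::] => 1
  | b :: s' =>
      match t pre with
      | Leaf _ => 0
      | Coin i => (if b then cd p i else 1 - cd p i) * path_prob t p (rcons pre b) s'
      | Const c => (if b then c else 1 - c) * path_prob t p (rcons pre b) s'
      end
  end.

Definition reach_prob (R : realType) (n : nat) (t : factory R n) (p : 'rV[R]_n)
    (s : seq bool) : R := path_prob t p [::] s.

Definition stop_prob (R : realType) (n : nat) (t : factory R n) (p : 'rV[R]_n)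
    (P : bool -> bool) (k : nat) : R :=
  \sum_(d < k.+1) \sum_(s : d.-tuple bool)
     (if t (tval s) is Leaf b then (if P b then reach_prob t p (tval s) else 0) else 0).

Definition implementable (R : realType) (n : nat) (K : set 'rV[R]_n)
    (f : 'rV[R]_n -> R) : Prop :=
  exists t : factory R n, valid_factory t /\
    forall p, K p ->
      (stop_prob t p predT) @ \oo --> (1 : R) /\
      (stop_prob t p id) @ \oo --> f p.

(* Partition [n] = A ⊔ S ⊔ B encoded by a map to {FA, FS, FB}. *)
Inductive part := FA | FS | FB.

Definition in_face (R : realType) (n : nat) (sigma : 'I_n -> part) (p : 'rV[R]_n) : Prop :=
  forall i, match sigma i with
            | FA => cd p i = 0
            | FS => 0 < cd p i < 1
            | FB => cd p i = 1
            end.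

Definition face_monomial (R : realType) (n : nat) (sigma : 'I_n -> part) (p : 'rV[R]_n) : R :=
  \prod_(i < n) match sigma i with
                | FA => 1 - cd p i
                | FS => cd p i * (1 - cd p i)
                | FB => cd p i
                end.

Definition poly_bounded (R : realType) (n : nat) (K : set 'rV[R]_n) (h : 'rV[R]_n -> R) : Prop :=
  exists (m : nat) (c : R), 0 < c /\
    forall sigma : 'I_n -> part,
      (exists q, K q /\ in_face sigma q /\ 0 < h q) ->
      forall p, K p -> c * (face_monomial sigma p) ^+ m <= h p.

(* Main.v *)
Require Import Defs.
From HB Require Import structures.
From mathcomp Require Import all_boot all_order all_algebra.
From mathcomp Require Import all_classical all_reals all_analysis.
From mathcomp Require Import ring lra.
Import Order.TTheory GRing.Theory Num.Theory.
Import numFieldNormedType.Exports.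
Set Implicit Arguments. Unset Strict Implicit. Unset Printing Implicit Defensive.
Local Open Scope classical_set_scope.
Local Open Scope ring_scope.

(* Necessity: the probability of reaching a leaf within [k] tosses is a continuous function of [p],
   and [f] is squeezed between two such functions; a single path to a leaf has probability at least
   a constant times a power of the face monomial of any point from which it can be followed.

   Sufficiency: it is enough to write [f = P(1) + P(continue) * g] on [K], where [P] is the law of a
   finite tree with outcomes 1, 0, "continue", where [P(continue) <= 15/16], and where [g] satisfies
   the same hypotheses as [f]; then one iterates.  With probability 1/4 the tree computes an empirical
   estimate of [p], selects a nearby center [c] in [K] and proposes the answer [1/2 <= f c].  The
   proposal is accepted only if one of [L] attempts succeeds in observing an event of probability
   [mon^m], with [mon] the face monomial of the face of [c].  If the estimate is accurate, the
   acceptance probability is at least 1/2; if it is not, polynomial boundedness of [f] (resp. [1 - f])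
   bounds the probability of a wrong answer 1 (resp. 0) by a multiple of [f p] (resp. [1 - f p]), which
   Chebyshev's inequality makes small.  Hence [g] and [1 - g] are comparable with [f] and [1 - f]. *)

(** * Probability of reaching a leaf, face monomials *)

Section Hit.
Context {R : realType} {n : nat}.
Implicit Types (t : factory R n) (p q : 'rV[R]_n) (P : bool -> bool).

Definition cube p := forall i, 0 <= cd p i <= 1.

Definition toss_prob p (l : label R n) : R :=
  match l with Coin i => cd p i | Const c => c | Leaf _ => 0 end.

(** Probability of reaching from node [pre], within [k] further tosses, a leaf whose label satisfies
    [P]. Recursing on the first toss turns later estimates into inductions on [k]. *)
Fixpoint hit t p P (pre : seq bool) k : R :=
  match t pre with
  | Leaf b => (P b)%:R
  | l => if k is k'.+1 then
           (1 - toss_prob p l) * hit t p P (rcons pre false) k'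
           + toss_prob p l * hit t p P (rcons pre true) k'
         else 0
  end.

Lemma sum_tuple_cons d (F : seq bool -> R) :
  \sum_(s : d.+1.-tuple bool) F s
  = \sum_(s : d.-tuple bool) F (false :: s) + \sum_(s : d.-tuple bool) F (true :: s).
Proof.
rewrite (reindex (fun z : bool * d.-tuple bool => [tuple of z.1 :: z.2])) /=; last first.
  exists (fun s : d.+1.-tuple bool => (thead s, [tuple of behead s])).
  - by move=> [b s] _ /=; congr pair; apply: val_inj.
  - by move=> s _; apply: val_inj => /=; rewrite [in RHS](tuple_eta s).
by rewrite -(pair_big xpredT xpredT (fun b (s : d.-tuple bool) => F (b :: s))) /= big_bool addrC.
Qed.

(** Stated at an arbitrary node so that induction on [k] can pass to the children; paths are split
    by their first outcome. *)
Lemma hitE t p P pre k :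
  \sum_(d < k.+1) \sum_(s : d.-tuple bool)
     (if t (pre ++ s) is Leaf b then (if P b then path_prob t p pre s else 0) else 0)
  = hit t p P pre k.
Proof.
pose G pre s := if t (pre ++ s) is Leaf b then (if P b then path_prob t p pre s else 0) else 0.
have Gcons r b s : G r (b :: s) = match t r with Leaf _ => 0 | l =>
    (if b then toss_prob p l else 1 - toss_prob p l) * G (rcons r b) s end.
  rewrite /G /= -cat_rcons; case: (t r) => [i|c|b'] /=; case: (t _) => [?|?|b2] //=;
   try case: (P b2); by rewrite ?mulr0.
have sum0 r : \sum_(s : 0.-tuple bool) G r s = if t r is Leaf b then (P b)%:R else 0.
  rewrite (big_pred1 [tuple]) => [|s]; last by apply/esym/eqP; rewrite tuple0.
  by rewrite /G cats0 /=; case: (t r) => // b; case: (P b).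
rewrite -[LHS]/(\sum_(d < k.+1) \sum_(s : d.-tuple bool) G pre s).
elim: k pre => [|k IH] pre; first by rewrite big_ord1 sum0 /=; case: (t pre).
rewrite big_ord_recl sum0 /=.
rewrite (eq_bigr (fun d : 'I_k.+1 => \sum_(s : d.-tuple bool) G pre (false :: s)
    + \sum_(s : d.-tuple bool) G pre (true :: s))); last first.
  by move=> d _; exact: sum_tuple_cons (G pre).
rewrite big_split /= -!IH.
under eq_bigr => d _ do (under eq_bigr => s _ do rewrite Gcons).
under [X in _ + (_ + X)]eq_bigr => d _ do (under eq_bigr => s _ do rewrite Gcons).
case: (t pre) => [i|c|b] /=.
- by rewrite add0r !mulr_sumr; congr (_ + _); apply: eq_bigr => d _; rewrite mulr_sumr.
- by rewrite add0r !mulr_sumr; congr (_ + _); apply: eq_bigr => d _; rewrite mulr_sumr.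
- by rewrite !big1 ?addr0 // => d _; rewrite big1.
Qed.

Lemma stop_probE t p P k : stop_prob t p P k = hit t p P [::] k.
Proof. exact: (hitE t p P [::] k). Qed.

Lemma toss_prob01 t p pre : valid_factory t -> cube p -> 0 <= toss_prob p (t pre) <= 1.
Proof.
move=> tv p01; case E: (t pre) => [i|c|b] /=; [exact: p01| |by rewrite lexx ler01].
by have /andP[c0 c1] := tv _ _ E; rewrite !ltW.
Qed.

Lemma hit_ge0 t p P pre k : valid_factory t -> cube p -> 0 <= hit t p P pre k.
Proof.
move=> tv p01; elim: k pre => [|k IH] pre /=; first by case: (t pre).
have /andP[w0 w1] := toss_prob01 pre tv p01.
by case: (t pre) w0 w1 => [i|c|b] // w0 w1; rewrite addr_ge0 // mulr_ge0 // subr_ge0.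
Qed.

Lemma hit_leS t p P pre k : valid_factory t -> cube p ->
  hit t p P pre k <= hit t p P pre k.+1.
Proof.
move=> tv p01; elim: k pre => [|k IH] pre /=.
  have := hit_ge0 P pre 1 tv p01; rewrite /=; by case: (t pre).
have /andP[w0 w1] := toss_prob01 pre tv p01; have IHf := IH (rcons pre false).
have IHt := IH (rcons pre true); move: IHf IHt => /=.
by case: (t pre) w0 w1 => [i|c|b] // w0 w1 IHf IHt; apply: lerD; apply: ler_wpM2l => //; rewrite subr_ge0.
Qed.

Lemma hit_mono t p P pre : valid_factory t -> cube p ->
  {homo hit t p P pre : k l / (k <= l)%N >-> k <= l}.
Proof. by move=> tv p01; apply: (homo_leq (@lexx _ R) (@le_trans _ R)) => k; exact: hit_leS. Qed.

Lemma hit_predT t p pre k : hit t p predT pre k = hit t p id pre k + hit t p negb pre k.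
Proof.
elim: k pre => [|k IH] pre /=; case: (t pre) => [i|c|[]] /=; rewrite ?addr0 ?add0r // !IH; ring.
Qed.

Lemma continuous_cd i : continuous (fun p : 'rV[R]_n => cd p i).
Proof. exact: coord_continuous. Qed.

Lemma continuous_mix (w u v : 'rV[R]_n -> R) :
  continuous w -> continuous u -> continuous v ->
  continuous (fun p => (1 - w p) * u p + w p * v p).
Proof.
move=> cw cu cv p.
have c1 : {for p, continuous (cst 1 - w)} by apply: continuousB; [exact: cst_continuous|exact: cw].
exact: (continuousD (continuousM c1 (cu p)) (continuousM (cw p) (cv p))).
Qed.

Lemma continuous_hit t P pre k : continuous (fun p => hit t p P pre k).
Proof.
elim: k pre => [|k IH] pre /=; case: (t pre) => [i|c|b]; try exact: cst_continuous.
- by apply: continuous_mix => //; exact: continuous_cd.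
- by apply: (@continuous_mix (fun=> c)) => //; exact: cst_continuous.
Qed.

End Hit.

(** * Face monomials as lower bounds for path probabilities *)

Section FaceMonomial.
Context {R : realType} {n : nat}.
Implicit Types (p q : 'rV[R]_n) (s : 'I_n -> part).

Definition face_factor s p i : R :=
  match s i with FA => 1 - cd p i | FS => cd p i * (1 - cd p i) | FB => cd p i end.

Lemma face_factor01 s p i : cube p -> 0 <= face_factor s p i <= 1.
Proof.
move=> /(_ i)/andP[p0 p1]; rewrite /face_factor; case: (s i); first lra; last lra.
by rewrite mulr_ge0 ?subr_ge0 // mulr_ile1 ?subr_ge0 // lerBlDr lerDl.
Qed.

Lemma face_monomialE s p : face_monomial s p = \prod_i face_factor s p i.
Proof. by []. Qed.

Lemma face_monomial_ge0 s p : cube p -> 0 <= face_monomial s p.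
Proof. by move=> p01; apply: prodr_ge0 => i _; case/andP: (face_factor01 s i p01). Qed.

Lemma face_monomial_le s p i : cube p -> face_monomial s p <= face_factor s p i.
Proof.
move=> p01; rewrite face_monomialE (bigD1 i) //=.
have /andP[f0 f1] := face_factor01 s i p01.
by apply: ler_piMr => //; apply: prodr_ile1 => j _; exact: face_factor01.
Qed.

Lemma face_monomial_le1 s p : cube p -> face_monomial s p <= 1.
Proof. by move=> p01; apply: prodr_ile1 => j _; exact: face_factor01. Qed.

Lemma face_monomial_gt0 s p : in_face s p -> 0 < face_monomial s p.
Proof.
move=> ps; rewrite face_monomialE; apply: prodr_gt0 => i _.
have := ps i; rewrite /face_factor; case: (s i) => [->|/andP[p0 p1]|->].
- by rewrite subr0.
- by rewrite mulr_gt0 ?subr_gt0.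
- by [].
Qed.

Lemma face_monomial_le_cd s p q i : cube p -> in_face s q -> 0 < cd q i ->
  face_monomial s p <= cd p i.
Proof.
move=> p01 qs q0; apply: le_trans (face_monomial_le s i p01) _.
have /andP[p0 p1] := p01 i; have := qs i; rewrite /face_factor; case: (s i) => [q0'|_|_] //.
  by rewrite q0' ltxx in q0.
by rewrite ler_piMr // lerBlDr lerDl.
Qed.

Lemma face_monomial_le_cdC s p q i : cube p -> in_face s q -> cd q i < 1 ->
  face_monomial s p <= 1 - cd p i.
Proof.
move=> p01 qs q1; apply: le_trans (face_monomial_le s i p01) _.
have /andP[p0 p1] := p01 i; have := qs i; rewrite /face_factor; case: (s i) => [_|_|q1'] //.
  by rewrite ler_piMl // subr_ge0.
by rewrite q1' ltxx in q1.
Qed.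

Lemma continuous_face_monomial s : continuous (face_monomial s : 'rV[R]_n -> R).
Proof.
apply: continuous_big => [|i _ p]; first exact: mul_continuous.
have cc := @continuous_cd R n i p.
have c1 : {for p, continuous (cst 1 - (fun p : 'rV[R]_n => cd p i))}.
  by apply: continuousB; [exact: cst_continuous|exact: cc].
by case: (s i) => //; exact: continuousM cc c1.
Qed.

Lemma face_exists p : cube p -> exists s, in_face s p.
Proof.
move=> p01; exists (fun i => if cd p i == 0 then FA else if cd p i == 1 then FB else FS) => i.
have /andP[p0 p1] := p01 i; case: eqP => // /eqP p0'; case: eqP => // /eqP p1'.
by rewrite !lt_neqAle p0 p1 eq_sym p0' p1'.
Qed.

(** A path that has positive probability at [q] uses only outcomes possible at [q]. At any [p], such
    an outcome has probability at least a constant times the face monomial, the constant being 1 for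
    a coin; at most [k] factors are multiplied, and the monomial is at most 1. *)
Lemma hit_face t q s P pre k : valid_factory t -> cube q -> in_face s q ->
  0 < hit t q P pre k ->
  exists c, 0 < c <= 1 /\ forall p, cube p -> c * face_monomial s p ^+ k <= hit t p P pre k.
Proof.
move=> tv q01 qs; elim: k pre => [|k IH] pre /=.
  case: (t pre) => [i|c|b]; rewrite ?ltxx // => P0; exists 1; split; first by rewrite ltr01 lexx.
  move=> p _; rewrite expr0 mulr1; by case: (P b) P0 => //; rewrite ltxx.
(* Coins and constants are treated together: [w] is the probability of outcome 1. *)
have node (w : 'rV[R]_n -> R) : (forall p, cube p -> 0 <= w p <= 1) ->
    (0 < w q -> exists2 c, 0 < c <= 1 & forall p, cube p -> c * face_monomial s p <= w p) ->
    (w q < 1 -> exists2 c, 0 < c <= 1 & forall p, cube p -> c * face_monomial s p <= 1 - w p) ->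
    0 < (1 - w q) * hit t q P (rcons pre false) k + w q * hit t q P (rcons pre true) k ->
    exists c, 0 < c <= 1 /\ forall p, cube p -> c * face_monomial s p ^+ k.+1 <=
      (1 - w p) * hit t p P (rcons pre false) k + w p * hit t p P (rcons pre true) k.
  move=> w01 w0 w1 H.
  have hf0 p : cube p -> 0 <= hit t p P (rcons pre false) k by exact: hit_ge0.
  have ht0 p : cube p -> 0 <= hit t p P (rcons pre true) k by exact: hit_ge0.
  have key (u v h : 'rV[R]_n -> R) :
      (exists2 c, 0 < c <= 1 & forall p, cube p -> c * face_monomial s p <= u p) ->
      (exists c, 0 < c <= 1 /\ forall p, cube p -> c * face_monomial s p ^+ k <= h p) ->
      (forall p, cube p -> u p * h p <= v p) ->
      exists c, 0 < c <= 1 /\ forall p, cube p -> c * face_monomial s p ^+ k.+1 <= v p.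
    move=> [c /andP[c0 c1] cu] [d [/andP[d0 d1] dh]] uv; exists (c * d); split.
      by rewrite mulr_gt0 // mulr_ile1 // ltW.
    move=> p p01; apply: le_trans (uv p p01); rewrite exprS mulrACA.
    by apply: ler_pM; [apply: mulr_ge0; [exact: ltW|exact: face_monomial_ge0]|
      apply: mulr_ge0; [exact: ltW|apply: exprn_ge0; exact: face_monomial_ge0]|exact: cu|exact: dh].
  have /andP[wq0 wq1] := w01 _ q01.
  (* A positive sum of nonnegative terms has a positive term; the path continues into that child. *)
  have [h0|h0] := ltP 0 ((1 - w q) * hit t q P (rcons pre false) k).
    have [w1' h0'] : w q < 1 /\ 0 < hit t q P (rcons pre false) k.
      rewrite lt_neqAle wq1 andbT; split.
        by apply: contraTneq h0 => ->; rewrite subrr mul0r ltxx.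
      by rewrite lt_neqAle hf0 // andbT; apply: contraTneq h0 => <-; rewrite mulr0 ltxx.
    apply: (key (fun p => 1 - w p) _ (fun p => hit t p P (rcons pre false) k)).
    - exact: w1.
    - exact: IH.
    - by move=> p p01; rewrite lerDl mulr_ge0 ?ht0 //; case/andP: (w01 _ p01).
  have h1 : 0 < w q * hit t q P (rcons pre true) k by lra.
  have [w1' h1'] : 0 < w q /\ 0 < hit t q P (rcons pre true) k.
    rewrite !lt_neqAle wq0 ht0 // !andbT; split.
      by apply: contraTneq h1 => <-; rewrite mul0r ltxx.
    by apply: contraTneq h1 => <-; rewrite mulr0 ltxx.
  apply: (key (fun p => w p) _ (fun p => hit t p P (rcons pre true) k)).
  - exact: w0.
  - exact: IH.
  - by move=> p p01; rewrite lerDr mulr_ge0 ?hf0 // subr_ge0; case/andP: (w01 _ p01).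
have w01 p : cube p -> 0 <= toss_prob p (t pre) <= 1 by exact: toss_prob01.
move: w01; case E: (t pre) => [i|c|b] w01.
- apply: (node (fun p => cd p i)) => // q'; exists 1; rewrite ?ltr01 ?lexx // => p p01; rewrite mul1r.
    exact: (face_monomial_le_cd p01 qs).
  exact: (face_monomial_le_cdC p01 qs).
- have /andP[c0 c1] := tv _ _ E.
  apply: (node (fun=> c)) => // _.
    exists c; rewrite ?c0 ?ltW // => p p01; apply: ler_piMr; [exact: ltW|exact: face_monomial_le1].
  exists (1 - c); first lra.
  move=> p p01; apply: ler_piMr; [lra|exact: face_monomial_le1].
- move=> P0; exists 1; split; first by rewrite ltr01 lexx.
  move=> p p01; rewrite mul1r; case: (P b) P0 => /=; rewrite ?ltxx // => _.
  by apply: exprn_ile1; [exact: face_monomial_ge0|exact: face_monomial_le1].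
Qed.

End FaceMonomial.

(** * Necessity *)

Lemma cvg_hit_negb (R : realType) (n : nat) (t : factory R n) p (l : R) :
  hit t p predT [::] k @[k --> \oo] --> (1 : R) -> hit t p id [::] k @[k --> \oo] --> l ->
  hit t p negb [::] k @[k --> \oo] --> 1 - l.
Proof.
have -> : hit t p negb [::] = hit t p predT [::] - hit t p id [::].
  by apply/funext => k; rewrite !fctE hit_predT addrC addKr.
exact: cvgB.
Qed.

Section Necessity.
Context {R : realType} {n : nat} (K : set 'rV[R]_n).
Hypothesis K01 : forall p, K p -> cube p.

(** There are finitely many faces: the sum of the exponents dominates each exponent, and the product
    of the constants, all at most 1, lies below each constant. *)
Lemma uniform_over_faces (Q : ('I_n -> part) -> nat -> R -> Prop) :
  (forall s, exists m c, 0 < c <= 1 /\ Q s m c) ->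
  (forall s m m' c c', (m <= m')%N -> 0 < c' <= c -> Q s m c -> Q s m' c') ->
  exists m c, 0 < c /\ forall s, Q s m c.
Proof.
move=> Qex Qmono.
(* The faces are enumerated through a finite type of codes. *)
pose dec (e : {ffun 'I_n -> option bool}) i :=
  match e i with None => FS | Some true => FB | Some false => FA end.
have decK s : exists e, dec e = s.
  exists [ffun i => match s i with FS => None | FB => Some true | FA => Some false end].
  by apply/funext => i; rewrite /dec ffunE; case: (s i).
have /choice[mc mcP] : forall e, exists mc : nat * R, 0 < mc.2 <= 1 /\ Q (dec e) mc.1 mc.2.
  by move=> e; have [m [c H]] := Qex (dec e); exists (m, c).
have c01 e : 0 < (mc e).2 <= 1 by case: (mcP e).
exists (\sum_e (mc e).1)%N, (\prod_e (mc e).2); split.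
  by apply: prodr_gt0 => e _; case/andP: (c01 e).
move=> s; have [e <-] := decK s; have [_] := mcP e; apply: Qmono.
  by rewrite (bigD1 e) //= leq_addr.
apply/andP; split; first by apply: prodr_gt0 => i _; case/andP: (c01 i).
rewrite (bigD1 e) //=; have /andP[c0 _] := c01 e.
apply: ler_piMr; [exact: ltW|apply: prodr_ile1 => i _].
by have /andP[/ltW -> ->] := c01 i.
Qed.

Lemma poly_bounded_le_exp (s : 'I_n -> part) (p : 'rV[R]_n) (c c' : R) m m' :
  cube p -> (m <= m')%N -> 0 < c' <= c ->
  c' * face_monomial s p ^+ m' <= c * face_monomial s p ^+ m.
Proof.
move=> p01 mm /andP[c'0 c'c]; apply: ler_pM => //; first exact: ltW.
  by apply: exprn_ge0; exact: face_monomial_ge0.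
by apply: ler_wiXn2l => //; [exact: face_monomial_ge0|exact: face_monomial_le1].
Qed.

Variable t : factory R n.
Hypothesis tv : valid_factory t.

Lemma hit_le_lim p P l k : cube p -> hit t p P [::] k @[k --> \oo] --> l ->
  hit t p P [::] k <= l.
Proof.
move=> p01 hl; rewrite -(cvg_lim (@Rhausdorff R) hl).
apply: nondecreasing_cvgn_le; last by apply/cvg_ex; exists l.
by apply/nondecreasing_seqP => j; exact: hit_leS.
Qed.

(** If [h q > 0], some finite depth [k] already has positive hit probability at [q]; [hit_face]
    bounds it below at every [p], and it never exceeds the limit. The exponent is this depth. *)
Lemma poly_bounded_hit P (h : 'rV[R]_n -> R) :
  (forall p, K p -> hit t p P [::] k @[k --> \oo] --> h p) -> poly_bounded K h.
Proof.
move=> hl; apply: (@uniform_over_faces (fun s m c =>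
  (exists q, K q /\ in_face s q /\ 0 < h q) ->
  forall p, K p -> c * face_monomial s p ^+ m <= h p)).
  move=> s; have [[q [Kq [qs hq]]]|nq] := pselect (exists q, K q /\ in_face s q /\ 0 < h q); last first.
    by exists 0%N, 1; rewrite ltr01 lexx; split.
  have [k] := filter_ex (cvgr_gt _ (hl q Kq) _ hq).
  move=> /(hit_face tv (K01 Kq) qs)[c [c01 cP]].
  exists k, c; split => // _ p Kp; apply: le_trans (cP p (K01 Kp)) _.
  exact: hit_le_lim (K01 Kp) (hl p Kp).
move=> s m m' c c' mm cc H /H {}H p Kp; apply: le_trans (H p Kp).
exact: poly_bounded_le_exp (K01 Kp) mm cc.
Qed.

(** The distance from [f] to its depth-[k] approximation is at most the probability of not having
    stopped. That probability is continuous, so once small at [p] it is small near [p]. *)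
Lemma continuous_hit_lim (f : 'rV[R]_n -> R) :
  (forall p, K p -> hit t p predT [::] k @[k --> \oo] --> (1 : R)) ->
  (forall p, K p -> hit t p id [::] k @[k --> \oo] --> f p) ->
  {within K, continuous f}.
Proof.
move=> h1 hf.
have hg p : K p -> hit t p negb [::] k @[k --> \oo] --> 1 - f p.
  by move=> Kp; exact: cvg_hit_negb (h1 p Kp) (hf p Kp).
have err p k : K p -> `|f p - hit t p id [::] k| <= 1 - hit t p predT [::] k.
  move=> Kp; have := hit_le_lim k (K01 Kp) (hf p Kp).
  have := hit_le_lim k (K01 Kp) (hg p Kp); rewrite hit_predT => a b.
  by rewrite ger0_norm ?subr_ge0 //; lra.
apply/subspace_continuousP => p Kp; apply/cvgrPdist_lt => e e0.
(* One [e / 4] each for the tail at [p], the tail at [q] and the variation of the approximation. *)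
have e4 : 0 < e / 4 by lra.
have lt1 : 1 - e / 4 < 1 by lra.
have [k kP] := filter_ex (cvgr_gt _ (h1 p Kp) _ lt1).
have cT := @continuous_hit R n t predT [::] k p.
have cid := @continuous_hit R n t id [::] k p.
have nT : \forall q \near p, 1 - e / 4 < hit t q predT [::] k by exact: (cvgr_gt _ cT _ kP).
have nid : \forall q \near p, `|hit t p id [::] k - hit t q id [::] k| < e / 4.
  by move/cvgrPdist_lt: cid; exact.
rewrite near_withinE; near=> q => Kq.
have hq : 1 - e / 4 < hit t q predT [::] k by near: q.
have hid : `|hit t p id [::] k - hit t q id [::] k| < e / 4 by near: q.
have := err p k Kp; have := err q k Kq; move: hid.
rewrite !ltr_norml !ler_norml => /andP[? ?] /andP[? ?] /andP[? ?].
by rewrite /from_subspace; apply/andP; split; lra.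
Unshelve. all: by end_near. Qed.

End Necessity.

Lemma implementable_necessary (R : realType) (n : nat) (K : set 'rV[R]_n) (f : 'rV[R]_n -> R) :
  (forall p, K p -> cube p) -> implementable K f ->
  {within K, continuous f} /\ poly_bounded K f /\ poly_bounded K (fun p => 1 - f p).
Proof.
move=> K01 [t [tv tP]].
have stopE p P : stop_prob t p P = hit t p P [::] by apply/funext => k; exact: stop_probE.
have h1 p : K p -> hit t p predT [::] k @[k --> \oo] --> (1 : R).
  by move=> /tP[]; rewrite stopE.
have hf p : K p -> hit t p id [::] k @[k --> \oo] --> f p.
  by move=> /tP[_]; rewrite stopE.
split; [|split]; [exact: (continuous_hit_lim K01 tv h1 hf)|exact: (poly_bounded_hit K01 tv hf)|].
apply: (poly_bounded_hit K01 tv (P := negb)) => p Kp.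
exact: cvg_hit_negb (h1 p Kp) (hf p Kp).
Qed.

(** * Finite trees and their iteration *)

Inductive ftree (n : nat) (O : Type) : Type :=
  | Out of O
  | Toss of option 'I_n & ftree n O & ftree n O.
Arguments Out {n O}. Arguments Toss {n O}.

Section FiniteTrees.
Context {R : realType} {n : nat}.
Implicit Types p : 'rV[R]_n.

(* [None] stands for a fair coin. *)
Definition bias p (i : option 'I_n) : R := if i is Some j then cd p j else 2^-1.

Fixpoint ev {O} p (T : ftree n O) (u : O -> R) : R :=
  match T with
  | Out o => u o
  | Toss i T0 T1 => (1 - bias p i) * ev p T0 u + bias p i * ev p T1 u
  end.

Fixpoint bind {O O'} (T : ftree n O) (k : O -> ftree n O') : ftree n O' :=
  match T with
  | Out o => k o
  | Toss i T0 T1 => Toss i (bind T0 k) (bind T1 k)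
  end.

Fixpoint depth {O} (T : ftree n O) : nat :=
  match T with Out _ => 0 | Toss _ T0 T1 => (maxn (depth T0) (depth T1)).+1 end.

Lemma bias01 p i : cube p -> 0 <= bias p i <= 1.
Proof. by move=> p01; case: i => [i|] /=; [exact: p01|lra]. Qed.

Section Expectation.
Context {O : Type}.
Implicit Types (T : ftree n O) (u v : O -> R).

Lemma ev_bind O' p T (k : O -> ftree n O') (u : O' -> R) :
  ev p (bind T k) u = ev p T (fun o => ev p (k o) u).
Proof. by elim: T => //= i T0 -> T1 ->. Qed.

Lemma evD p T u v : ev p T (fun o => u o + v o) = ev p T u + ev p T v.
Proof. by elim: T => //= i T0 -> T1 ->; ring. Qed.

Lemma evZ p T c u : ev p T (fun o => c * u o) = c * ev p T u.
Proof. by elim: T => //= i T0 -> T1 ->; ring. Qed.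

Lemma ev_cst p T c : ev p T (fun=> c) = c.
Proof. by elim: T => //= i T0 -> T1 ->; ring. Qed.

Lemma ev_sum p T (I : Type) (r : seq I) (F : I -> O -> R) :
  ev p T (fun o => \sum_(i <- r) F i o) = \sum_(i <- r) ev p T (F i).
Proof.
elim: r => [|i r IH].
  by rewrite big_nil -[RHS](ev_cst p T); congr ev; apply/funext => o; rewrite big_nil.
by rewrite big_cons -IH -evD; congr ev; apply/funext => o; rewrite big_cons.
Qed.

Lemma ler_ev p T u v : cube p -> (forall o, u o <= v o) -> ev p T u <= ev p T v.
Proof.
move=> p01 uv; elim: T => //= i T0 IH0 T1 IH1; have /andP[b0 b1] := bias01 i p01.
by apply: lerD; apply: ler_wpM2l => //; rewrite subr_ge0.
Qed.

Lemma ev_ge0 p T u : cube p -> (forall o, 0 <= u o) -> 0 <= ev p T u.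
Proof. by move=> p01 u0; rewrite -(ev_cst p T 0); exact: ler_ev. Qed.

Lemma continuous_ev T u : continuous (fun p => ev p T u).
Proof.
elim: T => [out|i T0 IH0 T1 IH1] /=; first exact: cst_continuous.
apply: continuous_mix => //; case: i => [i|] /=; [exact: continuous_cd|exact: cst_continuous].
Qed.

End Expectation.
End FiniteTrees.

(** * Infinite factories obtained by chaining finite trees *)

Section Chain.
Context {R : realType} {n : nat} {Y : Type}.
Variables (tr : Y -> ftree n (option bool)) (nx : Y -> Y).

(* In the state [(T, y)] the tree [T] is being run, and the outcome [None] restarts
   with the tree [tr y] after a dummy fair toss. *)
Definition node (x : ftree n (option bool) * Y) : label R n :=
  match x.1 with
  | Out (Some b) => Leaf b
  | Toss (Some i) _ _ => Coin i
  | _ => Const 2^-1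
  end.

Definition next (x : ftree n (option bool) * Y) (b : bool) : ftree n (option bool) * Y :=
  match x.1 with
  | Out (Some _) => x
  | Out None => (tr x.2, nx x.2)
  | Toss _ T0 T1 => (if b then T1 else T0, x.2)
  end.

(** Starting from [Out None] makes the root a restart point like every later one. *)
Definition chain_factory (y : Y) : factory R n :=
  fun s => node (foldl next (Out None, y) s).

Lemma chain_factory_valid y : valid_factory (chain_factory y).
Proof.
move=> s c; rewrite /chain_factory /node; case: (foldl _ _ _) => -[[b|]|[i|] T0 T1] z //= [<-]; lra.
Qed.

(** Payoff of one round: the test [P] on an answer, the value [c] on a restart. With [xpred0] and 1
    its expectation is the probability of restarting. *)
Definition restart (P : bool -> bool) (c : R) (o : option bool) : R :=
  if o is Some b then (P b)%:R else c.

Variables (y0 : Y) (p : 'rV[R]_n).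
Hypothesis p01 : cube p.
Let t := chain_factory y0.
Let state pre := foldl next (Out None, y0) pre.

(** A nonnegative solution [g] of the restart equation dominates every finite-depth probability,
    because running out of tosses pays 0 where [g] pays at least 0. *)
Lemma hit_chain_le P (g : Y -> R) : (forall y, 0 <= g y) ->
  (forall y, g y = ev p (tr y) (restart P (g (nx y)))) ->
  forall k pre T y, state pre = (T, y) -> hit t p P pre k <= ev p T (restart P (g y)).
Proof.
move=> g0 gE.
have ev0 T y : 0 <= ev p T (restart P (g y)) by apply: ev_ge0 => // -[b|] /=.
elim=> [|k IH] pre T y xE.
  rewrite /= /t /chain_factory -/(state pre) xE.
  by case: T {xE} (ev0 T y) => [[b|]|[i|] T0 T1].
have stb b : state (rcons pre b) = next (T, y) b by rewrite /state foldl_rcons -/(state pre) xE.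
rewrite /= {1 3}/t /chain_factory -/(state pre) xE.
case: T xE stb => [[b|]|i T0 T1] xE stb //=.
  have h b : hit t p P (rcons pre b) k <= g y by rewrite gE; apply: IH; rewrite stb.
  by have := h true; have := h false; lra.
have h0 : hit t p P (rcons pre false) k <= ev p T0 (restart P (g y)) by apply: IH; rewrite stb.
have h1 : hit t p P (rcons pre true) k <= ev p T1 (restart P (g y)) by apply: IH; rewrite stb.
have /andP[b0 b1] := bias01 i p01.
by case: i b0 b1 {xE stb} => [i|] /= b0 b1; apply: lerD; apply: ler_wpM2l => //; lra.
Qed.

(** After at most [depth T] tosses the tree [T] has either answered or reached a restart, and there
    [d] tosses remain; shallower branches have tosses to spare, which [hit_mono] absorbs. *)
Lemma hit_chain_depth (c : R) d y : 0 <= c ->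
  (forall pre, state pre = (Out None, y) -> 1 - hit t p predT pre d <= c) ->
  forall T pre, state pre = (T, y) ->
    1 - hit t p predT pre (depth T + d) <= ev p T (restart xpred0 c).
Proof.
move=> c0 Hd; elim=> [[b|]|i T0 IH0 T1 IH1] pre xE.
- case: d {Hd} => [|d]; rewrite /= {1}/t /chain_factory -/(state pre) xE /= subrr //.
- exact: Hd.
have stb b : state (rcons pre b) = next (Toss i T0 T1, y) b.
  by rewrite /state foldl_rcons -/(state pre) xE.
rewrite /= {1 3}/t /chain_factory -/(state pre) xE.
have tv : valid_factory t by exact: chain_factory_valid.
have h0 : 1 - hit t p predT (rcons pre false) (maxn (depth T0) (depth T1) + d)
    <= ev p T0 (restart xpred0 c).
  apply: le_trans (IH0 _ (stb false)); rewrite lerD2l lerN2.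
  by apply: hit_mono => //; rewrite leq_add2r leq_maxl.
have h1 : 1 - hit t p predT (rcons pre true) (maxn (depth T0) (depth T1) + d)
    <= ev p T1 (restart xpred0 c).
  apply: le_trans (IH1 _ (stb true)); rewrite lerD2l lerN2.
  by apply: hit_mono => //; rewrite leq_add2r leq_maxr.
have /andP[b0 b1] := bias01 i p01.
have b0' : 0 <= 1 - bias p i by rewrite subr_ge0.
have := ler_wpM2l b0' h0; have := ler_wpM2l b0 h1.
by case: i {b0 b1 b0' IH0 IH1 xE stb} => [i|] /=; lra.
Qed.

(** Each round leaves the run undecided with probability at most [beta]. The depth [d] depends on
    [y] because the trees met along the chain have no common depth bound. *)
Lemma hit_chain_geometric (beta : R) : 0 <= beta ->
  (forall y, ev p (tr y) (restart xpred0 1) <= beta) ->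
  forall j y, exists d, forall pre, state pre = (Out None, y) ->
    1 - hit t p predT pre d <= beta ^+ j.
Proof.
move=> beta0 trb; elim=> [|j IH] y.
  by exists 0%N => pre _; rewrite expr0 gerBl; apply: hit_ge0 => //; exact: chain_factory_valid.
(* The successor accounts for the dummy toss at the restart. *)
have [d Hd] := IH (nx y); exists (depth (tr y) + d).+1 => pre xE.
have stb b : state (rcons pre b) = (tr y, nx y) by rewrite /state foldl_rcons -/(state pre) xE.
rewrite /= {1 3}/t /chain_factory -/(state pre) xE /=.
have h b := hit_chain_depth (exprn_ge0 j beta0) Hd (stb b).
have evE : ev p (tr y) (restart xpred0 (beta ^+ j)) <= beta ^+ j.+1.
  have -> : restart xpred0 (beta ^+ j) = fun o => beta ^+ j * restart xpred0 1 o.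
    by apply/funext => -[b|] /=; rewrite ?mulr0 ?mulr1.
  by rewrite evZ exprSr; apply: ler_wpM2l; rewrite ?exprn_ge0.
by have := h true; have := h false; lra.
Qed.

(** The probabilities of answers 1 and 0 stay below [g y0] and [1 - g y0], while their sum tends to
    1; hence both bounds are attained in the limit. *)
Lemma cvg_hit_chain (beta : R) (g : Y -> R) : 0 <= beta < 1 ->
  (forall y, ev p (tr y) (restart xpred0 1) <= beta) ->
  (forall y, 0 <= g y <= 1) ->
  (forall y, g y = ev p (tr y) (restart id (g (nx y)))) ->
  hit t p predT [::] k @[k --> \oo] --> (1 : R) /\ hit t p id [::] k @[k --> \oo] --> g y0.
Proof.
move=> /andP[beta0 beta1] trb g01 gE.
have tv : valid_factory t by exact: chain_factory_valid.
have hid k : hit t p id [::] k <= g y0.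
  by apply: (@hit_chain_le id g _ gE k [::] (Out None) y0) => // y; case/andP: (g01 y).
(* [1 - g] solves the restart equation for the answer 0. *)
have hneg k : hit t p negb [::] k <= 1 - g y0.
  apply: (@hit_chain_le negb (fun y => 1 - g y) _ _ k [::] (Out None) y0) => // y.
    by rewrite subr_ge0; case/andP: (g01 y).
  rewrite gE -[X in X - _](ev_cst p (tr y)) -[X in _ - X]mul1r -mulNr -evZ -evD.
  by congr ev; apply/funext => -[[]|] /=; lra.
have h1 k : hit t p predT [::] k <= 1 by have := hid k; have := hneg k; rewrite hit_predT; lra.
have lim1 (e : R) : 0 < e -> \forall k \near \oo, 1 - e < hit t p predT [::] k.
  move=> e0.
  have /(cvgrPdist_lt _ _).1/(_ e e0) : beta ^+ k @[k --> \oo] --> (0 : R).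
    by apply: cvg_expr; rewrite ger0_norm.
  case/filter_ex => j; rewrite sub0r normrN ger0_norm ?exprn_ge0 // => bj.
  have [d Hd] := hit_chain_geometric beta0 trb j y0.
  exists d => // k /= dk; have := Hd [::] erefl.
  by have := hit_mono predT [::] tv p01 dk; lra.
split; apply/cvgrPdist_lt => e /lim1; apply: filterS => k; rewrite hit_predT => H.
  by rewrite ger0_norm ?subr_ge0; have := h1 k; rewrite hit_predT; lra.
by rewrite ger0_norm ?subr_ge0 //; have := hneg k; lra.
Qed.

End Chain.

(** The trees and the successor map do not depend on [p], only the values [g y p] do, so one factory
    serves all of [K]. *)
Lemma chain_implementable (R : realType) (n : nat) (K : set 'rV[R]_n) (Y : Type)
    (tr : Y -> ftree n (option bool)) (nx : Y -> Y) (g : Y -> 'rV[R]_n -> R) (beta : R) :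
  (forall p, K p -> cube p) -> 0 <= beta < 1 ->
  (forall y p, K p -> ev p (tr y) (restart xpred0 1) <= beta) ->
  (forall y p, K p -> 0 <= g y p <= 1) ->
  (forall y p, K p -> g y p = ev p (tr y) (restart id (g (nx y) p))) ->
  forall y, implementable K (g y).
Proof.
move=> K01 beta01 trb g01 gE y; exists (chain_factory tr nx y); split.
  exact: chain_factory_valid.
move=> p Kp; have stopE P : stop_prob (chain_factory tr nx y) p P = hit (chain_factory tr nx y) p P [::].
  by apply/funext => k; exact: stop_probE.
rewrite !stopE; apply: (@cvg_hit_chain _ _ _ _ _ y p (K01 p Kp) beta (fun y => g y p)) => // z.
- exact: trb.
- exact: g01.
- exact: gE.
Qed.

(** * Elementary trees and local faces *)

Section Gadgets.
Context {R : realType} {n : nat}.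
Implicit Types p : 'rV[R]_n.

Definition pr p (T : ftree n bool) : R := ev p T (fun b => b%:R).

Definition and_tree (T1 T2 : ftree n bool) := bind T1 (fun b => if b then T2 else Out false).

Definition or_tree (T1 T2 : ftree n bool) := bind T1 (fun b => if b then Out true else T2).

Lemma pr_and p T1 T2 : pr p (and_tree T1 T2) = pr p T1 * pr p T2.
Proof.
rewrite /pr ev_bind mulrC -evZ; congr ev; apply/funext => -[] /=; by rewrite ?mulr1 ?mulr0.
Qed.

(** Written for complements, so that iterated disjunctions become products. *)
Lemma pr_orC p T1 T2 : 1 - pr p (or_tree T1 T2) = (1 - pr p T1) * (1 - pr p T2).
Proof.
have -> : pr p (or_tree T1 T2) = pr p T2 + (1 - pr p T2) * pr p T1; last ring.
rewrite /pr ev_bind -evZ -[X in X + _](ev_cst p T1) -evD.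
by congr ev; apply/funext => -[] /=; ring.
Qed.

Lemma exists_pr_face (s : 'I_n -> part) : exists T, forall p, pr p T = face_monomial s p.
Proof.
pose coin i : ftree n bool := Toss (Some i) (Out false) (Out true).
pose coinC i : ftree n bool := Toss (Some i) (Out true) (Out false).
exists (\big[and_tree/Out true]_(i < n)
  match s i with FA => coinC i | FS => and_tree (coin i) (coinC i) | FB => coin i end) => p.
rewrite (big_morph (pr p) (pr_and p) (erefl : pr p (Out true) = 1)); apply: eq_bigr => i _.
case: (s i); rewrite ?pr_and /pr /=; ring.
Qed.

Lemma exists_pr_retry (s : 'I_n -> part) m L :
  exists T, forall p, pr p T = 1 - (1 - face_monomial s p ^+ m) ^+ L.
Proof.
have [T TE] := exists_pr_face s.
pose Tm := \big[and_tree/Out true]_(j < m) T.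
have TmE p : pr p Tm = face_monomial s p ^+ m.
  by rewrite (big_morph (pr p) (pr_and p) (erefl : pr p (Out true) = 1)) prodr_const card_ord TE.
exists (\big[or_tree/Out false]_(j < L) Tm) => p.
have idx : 1 - pr p (Out false) = 1 by rewrite /pr /= subr0.
have := big_morph (fun T => 1 - pr p T) (pr_orC p) idx (index_enum 'I_L) xpredT (fun=> Tm).
by rewrite prodr_const card_ord TmE => <-; ring.
Qed.

Fixpoint count (i : 'I_n) N : ftree n nat :=
  if N is N'.+1 then bind (count i N') (fun k => Toss (Some i) (Out k) (Out k.+1)) else Out 0%N.

(** The variance of a binomial variable, one toss at a time; the cross term vanishes because the new
    toss has mean [cd p i]. *)
Lemma ev_count p i N :
  ev p (count i N) (fun k => (k%:R - N%:R * cd p i) ^+ 2) = N%:R * (cd p i * (1 - cd p i)).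
Proof.
elim: N => [|N IH] /=; first by rewrite !mul0r subrr expr0n.
rewrite ev_bind /=.
transitivity (ev p (count i N) (fun k => (k%:R - N%:R * cd p i) ^+ 2 + cd p i * (1 - cd p i))).
  by congr ev; apply/funext => k; rewrite -!natr1; ring.
by rewrite evD ev_cst IH -natr1; ring.
Qed.

Fixpoint sample (r : seq 'I_n) N : ftree n ('I_n -> nat) :=
  if r is i :: r' then
    bind (sample r' N) (fun x => bind (count i N) (fun k => Out (fun j => if j == i then k else x j)))
  else Out (fun=> 0%N).

Lemma ev_sample p r N j : j \in r ->
  ev p (sample r N) (fun x => ((x j)%:R - N%:R * cd p j) ^+ 2) = N%:R * (cd p j * (1 - cd p j)).
Proof.
elim: r => //= i r IH; rewrite inE ev_bind.
case: eqVneq => [-> _|ji /= jr].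
  rewrite -[RHS](ev_cst p (sample r N)); congr ev; apply/funext => x.
  by rewrite ev_bind /= -ev_count; congr ev; apply/funext => k; rewrite eqxx.
rewrite -(IH jr); congr ev; apply/funext => x.
by rewrite ev_bind /= -[RHS](ev_cst p (count i N)); congr ev; apply/funext => k; rewrite (negPf ji).
Qed.

Definition far (d : R) p (x : 'I_n -> R) := [exists i, d <= `|x i - cd p i|].

(** Chebyshev's inequality with a union bound over the coins: [N] tosses of each coin fail with
    probability at most [n / (N * d ^+ 2)]. *)
Lemma exists_estimator (d e : R) : 0 < d -> 0 < e ->
  exists T : ftree n ('I_n -> R), forall p, cube p -> ev p T (fun x => (far d p x)%:R) <= e.
Proof.
move=> d0 e0; pose N := (Num.truncn (n%:R / (d ^+ 2 * e))).+1.
have N0 : (0 : R) < N%:R by rewrite ltr0n.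
have Ne : n%:R / (d ^+ 2 * e) <= N%:R by rewrite ltW // truncnS_gt.
exists (bind (sample (enum 'I_n) N) (fun x => Out (fun j => (x j)%:R / N%:R))) => p p01.
rewrite ev_bind /=.
(* If some coordinate is off by [d], its normalized squared deviation is already at least 1. *)
apply: (@le_trans _ _ (ev p (sample (enum 'I_n) N)
   (fun x => (N%:R * d) ^- 2 * \sum_i ((x i)%:R - N%:R * cd p i) ^+ 2))).
  apply: ler_ev => // x; case: (boolP (far _ _ _)) => [/existsP[i di]|_] /=; last first.
    apply: mulr_ge0; first by rewrite invr_ge0 exprn_ge0 // mulr_ge0 // ltW.
    by apply: sumr_ge0 => i _; exact: sqr_ge0.
  rewrite mulrC ler_pdivlMr ?mul1r; last by rewrite exprn_gt0 // mulr_gt0.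
  rewrite (bigD1 i) //= -[leLHS]addr0; apply: lerD; last by apply: sumr_ge0 => j _; exact: sqr_ge0.
  have -> : (x i)%:R - N%:R * cd p i = N%:R * ((x i)%:R / N%:R - cd p i) by field; rewrite gt_eqF.
  rewrite !exprMn; apply: ler_wpM2l; first exact: sqr_ge0.
  by rewrite -[leRHS]real_normK ?num_real // lerXn2r // nnegrE ltW.
rewrite evZ ev_sum mulrC ler_pdivrMr; last by rewrite exprn_gt0 // mulr_gt0.
apply: (@le_trans _ _ (\sum_(i < n) N%:R)).
  apply: ler_sum => i _; rewrite ev_sample ?mem_enum //.
  have /andP[p0 p1] := p01 i; rewrite ler_piMr ?(ltW N0) //.
  by rewrite mulr_ile1 ?subr_ge0 // lerBlDr lerDl.
rewrite sumr_const card_ord -[leLHS]mulr_natr.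
rewrite (_ : e * _ = N%:R * (N%:R * (d ^+ 2 * e))); last by ring.
by rewrite ler_pM2l // -ler_pdivrMr // mulr_gt0 // exprn_gt0.
Qed.

End Gadgets.

(** Near each [c] in [K], [f] is close to [f c] and the monomial of the face of [c] exceeds half its
    value at [c]. Compactness makes the scale uniform; a single [d] serves as radius and as lower
    bound. *)
Lemma exists_local_faces (R : realType) (n : nat) (K : set 'rV[R]_n) (f : 'rV[R]_n -> R) (eta : R) :
  (forall p, K p -> cube p) -> compact K -> {within K, continuous f} -> 0 < eta ->
  exists d : R, 0 < d <= 1 /\ forall q, K q -> exists c s, [/\ K c, in_face s c &
    forall p, (forall i, `|cd p i - cd q i| < d) ->
      (K p -> `|f p - f c| < eta) /\ d <= face_monomial s p].
Proof.
move=> K01 Kc /subspace_continuousP fc eta0.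
pose P (d : R) q := exists c s, [/\ K c, in_face s c &
    forall p, (forall i, `|cd p i - cd q i| < d) ->
      (K p -> `|f p - f c| < eta) /\ d <= face_monomial s p].
have cover : \forall d \near 0^'+, K `<=` P d.
  apply: ((compact_near_coveringP K).1 Kc _ _ P) => c Kc'.
  have [s cs] := face_exists (K01 _ Kc').
  have nf : \forall p \near c, K p -> `|f p - f c| < eta.
    have := fc c Kc' => /cvgrPdist_lt/(_ _ eta0); rewrite near_withinE.
    by apply: filterS => p H /H; rewrite distrC.
  have m0 := face_monomial_gt0 cs.
  have nm : \forall p \near c, face_monomial s c / 2 < face_monomial s p.
    have := @continuous_face_monomial R n s c.
    by move/(cvgr_gt _)/(_ (face_monomial s c / 2)); apply; lra.
  have [e /= e0 eP] := (nbhs_ballP c _).1 (filterI nf nm).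
  (* Half the radius is kept for the distance from [q] to [p]. *)
  exists (ball c (e / 2), [set d : R | 0 < d /\ d < Num.min (e / 2) (face_monomial s c / 2)]).
    split; first by apply: nbhsx_ballx; rewrite divr_gt0.
    by apply: filterI; [exact: nbhs_right_gt|apply: nbhs_right_lt; rewrite lt_min; apply/andP; split; lra].
  move=> [q d] /= [cq [d0]]; rewrite lt_min => /andP[de dm].
  exists c, s; split => // p pq.
  have /eP[H1 H2] : ball c e p.
    rewrite (splitr e); apply: ball_triangle cq _; split => [|i j]; first lra.
    rewrite ord1 /ball /= distrC; apply: lt_trans de; exact: pq.
  by split => //; rewrite ltW // (lt_trans dm).
have [d [[d0 d1] dP]] :=
  filter_ex (filterI (filterI (nbhs_right_gt (0 : R)) (nbhs_right_le (@ltr01 R))) cover).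
by exists d; rewrite d0 d1.
Qed.

(** * Sufficiency *)

Section Sufficiency.
Context {R : realType} {n : nat} (K : set 'rV[R]_n).
Hypotheses (K01 : forall p, K p -> cube p) (Kcompact : compact K).
Implicit Types (p : 'rV[R]_n) (f h : 'rV[R]_n -> R) (b : bool).

(** The probability with which the answer must be [b]; it lets both answers be treated at once. *)
Definition side f b p : R := if b then f p else 1 - f p.

Definition admissible f :=
  [/\ forall p, K p -> 0 <= f p <= 1, {within K, continuous f} & forall b, poly_bounded K (side f b)].

Definition ind (a o : option bool) : R := (o == a)%:R.

Lemma side_ge0 f b p : admissible f -> K p -> 0 <= side f b p.
Proof. by move=> [f01 _ _] /f01/andP[f0 f1]; rewrite /side; case: b; lra. Qed.

(** The upper bound shows that [h] is positive wherever [h'] is; the lower bound transfers the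
    estimate. *)
Lemma poly_bounded_squeeze h h' (a b : R) : 0 < a -> 0 < b ->
  (forall p, K p -> a * h p <= h' p <= b * h p) -> poly_bounded K h -> poly_bounded K h'.
Proof.
move=> a0 b0 hh [m [c [c0 H]]]; exists m, (a * c); split; first by rewrite mulr_gt0.
move=> s [q [Kq [qs q0]]] p Kp; have /andP[+ _] := hh p Kp; apply: le_trans.
rewrite -mulrA ler_pM2l //; apply: H => //; exists q; do 2!split => //.
by have /andP[_ /(lt_le_trans q0)] := hh q Kq; rewrite pmulr_rgt0.
Qed.

Lemma poly_bounded_sides f : admissible f ->
  exists m (c : R), 0 < c <= 1 /\ forall b s, (exists q, K q /\ in_face s q /\ 0 < side f b q) ->
    forall p, K p -> c * face_monomial s p ^+ m <= side f b p.
Proof.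
move=> [_ _ pb]; have [m1 [c1 [c10 H1]]] := pb true; have [m0 [c0 [c00 H0]]] := pb false.
exists (maxn m0 m1), (Num.min 1 (Num.min c0 c1)); split.
  by rewrite !lt_min ltr01 c00 c10 ge_min lexx.
move=> b s qex p Kp; have cle c : 0 < c -> (Num.min c0 c1 <= c) ->
    0 < Num.min 1 (Num.min c0 c1) <= c.
  by move=> _ cc; rewrite !lt_min ltr01 c00 c10 ge_min cc orbT.
case: b qex => qex.
  apply: le_trans (H1 s qex p Kp); apply: poly_bounded_le_exp; [exact: K01|exact: leq_maxr|].
  by apply: cle => //; rewrite ge_min lexx orbT.
apply: le_trans (H0 s qex p Kp); apply: poly_bounded_le_exp; [exact: K01|exact: leq_maxl|].
by apply: cle => //; rewrite ge_min lexx.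
Qed.

Lemma within_continuous_quotient f (u v : 'rV[R]_n -> R) :
  {within K, continuous f} -> continuous u -> continuous v -> (forall p, K p -> v p != 0) ->
  {within K, continuous (fun p => (f p - u p) / v p)}.
Proof.
move=> /subspace_continuousP fc cu cv v0; apply/subspace_continuousP => p Kp.
have fp : f @ within K (nbhs p) --> f p := fc p Kp.
have up : u @ within K (nbhs p) --> u p by apply: cvg_within_filter; exact: cu.
have vp : v @ within K (nbhs p) --> v p by apply: cvg_within_filter; exact: cv.
exact: (cvgM (cvgB fp up) (cvgV (v0 p Kp) vp)).
Qed.

Lemma ev_ind_le1 p S a : cube p -> ev p S (ind a) <= 1.
Proof. by move=> p01; rewrite -(ev_cst p S 1); apply: ler_ev => // o; rewrite /ind; case: eqP. Qed.

(** Union bound over [L] attempts of probability [v]. *)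
Lemma exprC_le (v : R) L : 0 <= v <= 1 -> 1 - (1 - v) ^+ L <= L%:R * v.
Proof.
move=> /andP[v0 v1]; elim: L => [|L IH]; first by rewrite expr0 subrr mul0r.
have e1 : (1 - v) ^+ L <= 1 by apply: exprn_ile1; lra.
rewrite exprS -natr1; have := ler_wpM2l v0 e1; lra.
Qed.

Lemma exists_expr_le_half (v : R) : 0 < v <= 1 -> exists L, (1 - v) ^+ L <= 2^-1.
Proof.
move=> /andP[v0 v1].
have /(cvgrPdist_lt _ _).1/(_ 2^-1 _) : (1 - v) ^+ k @[k --> \oo] --> (0 : R).
  by apply: cvg_expr; rewrite ger0_norm; lra.
case/(_ _)/filter_ex; first lra.
by move=> L; rewrite sub0r normrN => /ltW H; exists L; rewrite (le_trans (ler_norm _)).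
Qed.

Lemma exists_verified_answer f (d c0 : R) m L (x : 'I_n -> R) : admissible f ->
  0 < d <= 1 -> 0 < c0 <= 1 -> (1 - d ^+ m) ^+ L <= 2^-1 ->
  (forall q, K q -> exists c s, [/\ K c, in_face s c &
    forall p, (forall i, `|cd p i - cd q i| < d) ->
      (K p -> `|f p - f c| < 6^-1) /\ d <= face_monomial s p]) ->
  (forall b s, (exists q, K q /\ in_face s q /\ 0 < side f b q) ->
    forall p, K p -> c0 * face_monomial s p ^+ m <= side f b p) ->
  exists T, forall p, K p ->
    (~~ far (d / 2) p x -> ev p T (ind None) <= 2^-1 /\
       forall b, side f b p < 3^-1 -> ev p T (ind (Some b)) = 0) /\
    (forall b, ev p T (ind (Some b)) <= L%:R * (side f b p / c0)).
Proof.
move=> fadm /andP[d0 d1] /andP[c00 c01] Lhalf centers pb.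
have rhs0 b p : K p -> 0 <= L%:R * (side f b p / c0).
  by move=> Kp; apply: mulr_ge0 => //; apply: divr_ge0; [exact: side_ge0|exact: ltW].
(* If no point of [K] is near the estimate [x], then [x] is inaccurate for every [p] in [K], and
   always restarting is harmless. *)
have [[q [Kq xq]]|nq] := pselect (exists q, K q /\ forall i, `|x i - cd q i| < d / 2); last first.
  exists (Out None) => p Kp; split=> [|b]; last exact: rhs0.
  rewrite negb_exists => /forallP px; exfalso; apply: nq; exists p; split => // i.
  by have := px i; rewrite -ltNge.
have [c [s [Kc cs cP]]] := centers q Kq.
have [V VE] := @exists_pr_retry R n s m L.
pose T := bind V (fun v => Out (if v then Some (2^-1 <= f c) else None)).
have TN p : ev p T (ind None) = 1 - pr p V.
  rewrite /T ev_bind /= /pr -[X in X - _](ev_cst p V) -mulN1r -evZ -evD.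
  by congr ev; apply/funext => -[]; rewrite /ind /=; lra.
have TS p b : ev p T (ind (Some b)) = (b == (2^-1 <= f c))%:R * pr p V.
  rewrite /T ev_bind /= /pr -evZ.
  by congr ev; apply/funext => -[]; rewrite /ind /= ?mulr1 ?mulr0 // eq_sym.
(* The proposed answer has weight at least 1/2 at [c], so [c] is a witness for polynomial
   boundedness on its face. *)
have fc b : b = (2^-1 <= f c) -> 2^-1 <= side f b c.
  by rewrite /side => ->; case: (lerP 2^-1 (f c)); lra.
exists T => p Kp; have p01 := K01 Kp; have m0 := face_monomial_ge0 s p01.
have m1 := face_monomial_le1 s p01.
split=> [|b].
  rewrite negb_exists => /forallP px.
  have [] := cP p.
    move=> i; have := px i; rewrite -ltNge => pxi; have := xq i; move: pxi.
    by rewrite !ltr_norml => /andP[? ?] /andP[? ?]; apply/andP; split; lra.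
  move=> /(_ Kp) fpc dm; split.
    rewrite TN VE opprB addrC subrK; apply: le_trans Lhalf.
    have dm' : d ^+ m <= face_monomial s p ^+ m by apply: lerXn2r; rewrite ?nnegrE // ltW.
    have m1' := exprn_ile1 m m0 m1.
    by apply: lerXn2r; rewrite ?nnegrE; lra.
  (* A proposed [b] would have weight above 1/2 - 1/6 = 1/3 at [p], against [fp]. *)
  move=> b fp; rewrite TS; case: eqP; rewrite ?mul0r // => /fc.
  by move: fp fpc; rewrite /side ltr_norml => fp /andP[? ?]; case: b fp => ? ?; lra.
rewrite TS; case: eqP => [/fc fb|_]; last by rewrite mul0r rhs0.
rewrite mul1r VE; have v01 : 0 <= face_monomial s p ^+ m <= 1 by rewrite exprn_ge0 //= exprn_ile1.
apply: le_trans (exprC_le L v01) _; apply: ler_wpM2l => //.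
rewrite ler_pdivlMr // mulrC; apply: pb => //; exists c; do 2!split => //; lra.
Qed.

Lemma exists_sampler f : admissible f ->
  exists S, forall p, K p -> ev p S (ind None) <= 3 / 4 /\
    forall b, side f b p < 3^-1 -> ev p S (ind (Some b)) <= side f b p.
Proof.
move=> fadm; have [_ fcont _] := fadm.
have eta0 : (0 : R) < 6^-1 by lra.
have [d [d01 centers]] := exists_local_faces K01 Kcompact fcont eta0.
have [m [c0 [c01 pb]]] := poly_bounded_sides fadm.
have [d0 d1] := andP d01; have [c00 c0le1] := andP c01.
have [|L Lhalf] := @exists_expr_le_half (d ^+ m).
  by rewrite exprn_gt0 //= exprn_ile1 // ltW.
have /choice[inner innerP] x := @exists_verified_answer f d c0 m L x fadm d01 c01 Lhalf centers pb.
have L1 : (0 : R) < L%:R + 1 by rewrite natr1 ltr0n.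
(* This failure probability is at most 1/4, giving the restart bound 1/2 + 1/4, and times [L / c0]
   it is at most 1, so the errors are paid for by [side f b p]. *)
have e0 : 0 < c0 / (4 * (L%:R + 1)) by rewrite divr_gt0 // mulr_gt0.
have d20 : 0 < d / 2 by lra.
have [X XP] := @exists_estimator R n (d / 2) _ d20 e0.
exists (bind X inner) => p Kp; have p01 := K01 Kp; have XPp := XP p p01.
have eL : c0 / (4 * (L%:R + 1)) * L%:R <= c0.
  rewrite mulrAC ler_pdivrMr ?mulr_gt0 //; apply: ler_wpM2l; [exact: ltW|].
  have : (0 : R) <= L%:R by []. lra.
split.
  rewrite ev_bind; apply: (@le_trans _ _ (ev p X (fun x => 2^-1 + (far (d / 2) p x)%:R))).
    apply: ler_ev => // x; have [H _] := innerP x p Kp.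
    case: (boolP (far _ _ _)) H => /= [_ _|_ /(_ isT)[H _]]; last by rewrite addr0.
    by apply: le_trans (ev_ind_le1 _ _ p01) _; lra.
  rewrite evD ev_cst.
  have : c0 / (4 * (L%:R + 1)) <= 4^-1.
    by rewrite ler_pdivrMr ?mulr_gt0 //; have : (0 : R) <= L%:R by []; lra.
  by lra.
move=> b sb; rewrite ev_bind.
have s0 := side_ge0 b fadm Kp.
(* An answer of weight below 1/3 can only come from an inaccurate estimate. *)
apply: (@le_trans _ _ (ev p X (fun x => (L%:R * (side f b p / c0)) * (far (d / 2) p x)%:R))).
  apply: ler_ev => // x; have [H1 H2] := innerP x p Kp.
  case: (boolP (far _ _ _)) H1 => /= [_ _|_ /(_ isT)[_ H]]; first by rewrite mulr1.
  by rewrite mulr0 H.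
rewrite evZ; apply: le_trans (ler_wpM2l _ XPp) _; first by rewrite mulr_ge0 // divr_ge0 // ltW.
have sc0 : 0 <= side f b p / c0 by rewrite divr_ge0 // ltW.
rewrite mulrC [leLHS]mulrA; apply: le_trans (ler_wpM2r sc0 eL) _.
by rewrite mulrC divfK // gt_eqF.
Qed.

Lemma ev_restart p T P c :
  ev p T (restart P c) = (P true)%:R * ev p T (ind (Some true))
    + (P false)%:R * ev p T (ind (Some false)) + c * ev p T (ind None).
Proof.
rewrite -!evZ -!evD; congr ev; apply/funext => -[[]|] /=; rewrite /ind /=; ring.
Qed.

(** The remaining target [g] is forced by [f = a true + r * g]. It stays admissible because each
    answer uses up at most 11/12 of its weight, which makes both sides of [g] comparable with those
    of [f]. *)
Lemma exists_round f : admissible f ->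
  exists T g, admissible g /\ forall p, K p ->
    ev p T (restart xpred0 1) <= 15 / 16 /\ f p = ev p T (restart id (g p)).
Proof.
move=> fadm; have [S SP] := exists_sampler fadm.
(* Two fair tosses run [S] with probability 1/4; the restart probability is then at most 3/16 + 3/4
   = 15/16. *)
pose T := Toss None (Toss None S (Out None)) (Out None).
have TE p u : ev p T u = 4^-1 * ev p S u + 3 / 4 * u None by rewrite /=; field.
pose a b p := ev p T (ind (Some b)); pose r p := ev p T (ind None).
have aE p b : a b p = 4^-1 * ev p S (ind (Some b)) by rewrite /a TE /ind /= mulr0 addr0.
have rE p : r p = 4^-1 * ev p S (ind None) + 3 / 4 by rewrite /r TE /ind /= mulr1.
have sum1 p : a true p + a false p + r p = 1.
  by have := ev_restart p T xpredT 1; rewrite !mul1r => <-; rewrite -[RHS](ev_cst p T);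
    congr ev; apply/funext => -[].
have a0 b p : K p -> 0 <= a b p by move=> Kp; apply: ev_ge0 => [|o]; [exact: K01|rewrite /ind].
have r1 p : K p -> 3 / 4 <= r p <= 15 / 16.
  move=> Kp; have [SN _] := SP p Kp; rewrite rE.
  have : 0 <= ev p S (ind None) by apply: ev_ge0 => [|o]; [exact: K01|rewrite /ind].
  by move=> S0; apply/andP; split; lra.
have ab b p : K p -> a b p <= 11 / 12 * side f b p.
  move=> Kp; have [_ /(_ b) Sb] := SP p Kp; rewrite aE; have s0 := side_ge0 b fadm Kp.
  (* For weight at least 1/3 the trivial bound 1/4 suffices, as 1/4 <= 11/36. *)
  case: (ltP (side f b p) 3^-1) Sb => [_ /(_ isT)|s3 _]; first lra.
  by have := ev_ind_le1 S (Some b) (K01 Kp); lra.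
pose g p := (f p - a true p) / r p.
have r0 p : K p -> 0 < r p by move=> /r1; lra.
have sideE b p : K p -> side g b p * r p = side f b p - a b p.
  move=> Kp; have rn0 : r p != 0 by rewrite gt_eqF ?r0.
  rewrite /side /g; case: b; first by rewrite divfK.
  by rewrite mulrBl divfK // mul1r; have := sum1 p; lra.
have sideb b p : K p -> 12^-1 * side f b p <= side g b p <= 4 / 3 * side f b p.
  move=> Kp; have E := sideE b p Kp; have /andP[rl ru] := r1 p Kp; have := ab b p Kp.
  have := a0 b p Kp; have := side_ge0 b fadm Kp => s0 a0' ab'.
  have g0 : 0 <= side g b p by rewrite -(pmulr_lge0 _ (r0 p Kp)) E; lra.
  by apply/andP; split; nra.
exists T, g; split.
  split.
  - move=> p Kp; have := sideb true p Kp; have := sideb false p Kp.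
    have := side_ge0 true fadm Kp; have := side_ge0 false fadm Kp.
    by rewrite /side => ? ? /andP[? ?] /andP[? ?]; apply/andP; split; lra.
  - have [_ fc _] := fadm; apply: within_continuous_quotient => //.
    + exact: continuous_ev.
    + exact: continuous_ev.
    + by move=> p /r0 rp; rewrite gt_eqF.
  - move=> b; have [_ _ /(_ b)] := fadm; apply: poly_bounded_squeeze (sideb b); lra.
move=> p Kp; split.
  by rewrite ev_restart !mul0r !add0r mul1r; case/andP: (r1 p Kp).
rewrite ev_restart mul1r mul0r addr0 -/(a true p) -/(r p).
by rewrite /g divfK ?gt_eqF ?r0 // addrC subrK.
Qed.

(** The states of the chain are the admissible functions themselves; the bound 15/16 is common to
    all of them, so the rounds can be iterated forever. *)
Lemma implementable_sufficient f : admissible f -> implementable K f.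
Proof.
move=> fadm; pose Y := {g | admissible g}.
have /choice[trnx trnxP] : forall y : Y, exists z : ftree n (option bool) * Y, forall p, K p ->
    ev p z.1 (restart xpred0 1) <= 15 / 16 /\ sval y p = ev p z.1 (restart id (sval z.2 p)).
  move=> [g gadm]; have [T [g' [g'adm H]]] := exists_round gadm.
  by exists (T, exist _ g' g'adm).
apply: (@chain_implementable R n K Y (fun y => (trnx y).1) (fun y => (trnx y).2)
  (fun y => sval y) (15 / 16) K01 _ _ _ _ (exist _ f fadm)).
- lra.
- by move=> y p /(trnxP y)[].
- by move=> [g [g01 gc gb]] p /g01.
- by move=> y p /(trnxP y)[].
Qed.

End Sufficiency.

Theorem theorem2 (R : realType) (n : nat) (K : set 'rV[R]_n) (f : 'rV[R]_n -> R)
  (hK01 : forall p, K p -> forall i, 0 <= cd p i <= 1)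
  (hKc : compact K)
  (hf01 : forall p, K p -> 0 <= f p <= 1) :
  implementable K f <->
  ({within K, continuous f} /\ poly_bounded K f /\ poly_bounded K (fun p => 1 - f p)).
Proof.
split=> [|[fc [fb f1b]]]; first exact: implementable_necessary.
by apply: implementable_sufficient => //; split => // -[].
Qed.
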